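(* Let $r\ge 2$ be an integer, let $A$ be a nonnegative $r$-potent real square matrix with $\operatorname{rank}(A)>r-1$, and let $B$ be any non-zero nonnegative $r$-potent real square matrix. Then the Kronecker product $A\otimes B$ is a decomposable $r$-potent matrix with $\operatorname{rank}(A\otimes B)>r-1$.
   Context: A real matrix is nonnegative if all its entries are $\ge 0$. A square matrix $A$ is $r$-potent if $A^r=A$. A real square matrix $A$ is decomposable if there is a permutation matrix $P$ such that $P^{-1}AP=\begin{pmatrix} B' & C'\\ 0 & D'\end{pmatrix}$ with $B'$ and $D'$ square (of positive size). *)

(* Defs.v *)
From mathcomp Require Import all_boot all_order all_algebra all_fingroup.
From mathcomp Require Import reals.
From mathcomp Require Export mxtens.

Set Implicit Arguments.
Unset Strict Implicit.
Unset Printing Implicit Defensive.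

Import Order.TTheory GRing.Theory Num.Theory.
Local Open Scope ring_scope.

Definition nonneg_mx (R : realType) (m n : nat) (A : 'M[R]_(m, n)) : Prop :=
  forall i j, 0 <= A i j.

Definition potent_mx (R : realType) (r n : nat) (A : 'M[R]_n) : Prop :=
  A ^+ r = A.

(* The diagonal blocks have sizes p and q; the cast only identifies the
   dimension p + q of the block matrix with n. *)
Definition decomposable_mx (R : realType) (n : nat) (A : 'M[R]_n) : Prop :=
  exists2 P : 'M[R]_n, is_perm_mx P &
  exists (p q : nat) (e : (p + q)%N = n),
    [/\ (0 < p)%N, (0 < q)%N &
      exists (B' : 'M[R]_p) (C' : 'M[R]_(p, q)) (D' : 'M[R]_q),
        invmx P *m A *m P = castmx (e, e) (block_mx B' C' 0 D')].

(* Main.v *)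
(* Since rank (A (x) B) >= rank A, it suffices that a nonnegative r-potent M that
   is not decomposable has rank at most r - 1.  Put T = M + ... + M^(r-1), so that
   M T = T and T / (r - 1) is idempotent.  Indecomposability makes T positive, and
   a positive idempotent has rank 1, hence tr T <= r - 1.  As M^(r-1) is an
   idempotent with the rank of M and M >= 0, rank M = tr M^(r-1) <= tr T. *)

Require Import Defs.
From mathcomp Require Import all_boot all_order all_algebra all_fingroup.
From mathcomp Require Import reals mxtens.

Import Order.TTheory GRing.Theory Num.Theory.
Local Open Scope ring_scope.

(** In the rank factorization [E = C R], cancelling the full-rank factors in [C (R C) R = C R]
    leaves [R C = 1], of size [\rank E]; the trace is cyclic. *)
Lemma mxtrace_idempotent (F : fieldType) n (E : 'M[F]_n) :
  E *m E = E -> \tr E = (\rank E)%:R.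
Proof.
move=> EE; rewrite -{1}(mulmx_base E) mxtrace_mulC.
suff -> : row_base E *m col_base E = 1%:M by rewrite mxtrace1.
apply: (row_free_inj (row_base_free E)); apply: (row_full_inj (col_base_full E)).
by rewrite mul1mx /= mulmxA mulmxA mulmx_base -mulmxA mulmx_base EE.
Qed.

Lemma mxrank_mxsub (F : fieldType) m n p q (f : 'I_p -> 'I_m) (g : 'I_q -> 'I_n)
    (A : 'M[F]_(m, n)) : (\rank (mxsub f g A) <= \rank A)%N.
Proof.
have rowsub_rank k l h (C : 'M[F]_(k, l)) :
    (\rank (rowsub (h : 'I__ -> _) C : 'M_(p, l)) <= \rank C)%N.
  by rewrite mxrankS // rowsub_sub.
have -> : mxsub f g A = rowsub f (colsub g A) by apply/matrixP=> i j; rewrite !mxE.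
apply: leq_trans (rowsub_rank _ _ _ _) _.
by rewrite -mxrank_tr trmx_mxsub -[leqRHS]mxrank_tr mxrankS // rowsub_sub.
Qed.

(** A nonzero entry [B i j] makes the multiple [B i j *: A] a submatrix of [A *t B]. *)
Lemma mxrank_tensl (F : fieldType) m n p q (A : 'M[F]_(m, n)) (B : 'M[F]_(p, q)) :
  B != 0 -> (\rank A <= \rank (A *t B))%N.
Proof.
move=> /matrix0Pn[i [j Bij]].
rewrite -(mxrank_scale_nz A Bij); set C := _ *: _.
suff -> : C = mxsub (fun k => mxtens_index (k, i)) (fun l => mxtens_index (l, j))
    (A *t B) by apply: mxrank_mxsub.
by apply/matrixP=> k l; rewrite !mxE !mxtens_indexK /= mulrC.
Qed.

Lemma tensmx_exp (R : comPzRingType) m n (A : 'M[R]_m) (B : 'M[R]_n) k :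
  (0 < k)%N -> (A *t B) ^+ k = A ^+ k *t B ^+ k.
Proof.
case: k => // k _; elim: k => [//|k IH].
by rewrite exprS IH -mulmxE tensmx_mul !mulmxE -!exprS.
Qed.

(* Subtract from a column [x] of [Q] the largest multiple [t u] of a fixed column
   [u] with [x - t u >= 0]: the result is fixed by [Q] and has a zero entry, so it
   vanishes since [Q] is positive. *)
Lemma positive_idempotent_rank (R : realFieldType) n (Q : 'M[R]_n) :
  (forall i j, 0 < Q i j) -> Q *m Q = Q -> (\rank Q <= 1)%N.
Proof.
case: n Q => [|n] Q Q0 QQ; first by apply: leq_trans (rank_leq_row _) _.
pose u := col ord0 Q.
have Qcol j : Q *m col j Q = col j Q by rewrite colE mulmxA QQ.
suff H j : exists t, col j Q = t *: u.
  have [t tP] : exists t : 'rV_n.+1, forall j, col j Q = t ord0 j *: u.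
    have H' j : {t | col j Q == t *: u}.
      by apply: sigW; have [t ->] := H j; exists t.
    exists (\row_j sval (H' j)) => j; rewrite mxE; exact/eqP/(svalP (H' j)).
  have -> : Q = u *m t.
    apply/matrixP=> i j; rewrite mxE big_ord1.
    by move/matrixP: (tP j) => /(_ i ord0); rewrite !mxE mulrC.
  by apply: leq_trans (mxrankM_maxl _ _) (rank_leq_col _).
case: (@Order.TotalTheory.arg_minP _ _ _ ord0 xpredT
  (fun i => Q i j / Q i ord0)) => // i0 _ Hmin.
set t := Q i0 j / Q i0 ord0 in Hmin; exists t.
pose y := col j Q - t *: u.
have yE i : y i ord0 = Q i j - t * Q i ord0 by rewrite !mxE.
have y0 i : 0 <= y i ord0 by rewrite yE subr_ge0 -ler_pdivlMr ?Hmin.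
have Qy : Q *m y = y by rewrite mulmxBr -scalemxAr !Qcol.
have yi0 : y i0 ord0 = 0 by rewrite yE /t divfK ?subrr // gt_eqF.
apply/eqP; rewrite -subr_eq0; apply/eqP/matrixP=> k l; rewrite ord1 [RHS]mxE.
have := congr1 (fun v : 'cV__ => v i0 ord0) Qy; rewrite mxE yi0 => /eqP.
rewrite psumr_eq0; last by move=> l' _; rewrite mulr_ge0 // ltW.
move=> /allP /(_ k (mem_index_enum k)) /=.
by rewrite mulf_eq0 gt_eqF //= => /eqP.
Qed.

(** Listing the indices outside [S] before those in [S] moves the zero entries to the lower-left
    block. *)
Lemma decomposable_of_invariant_set (R : realType) n (M : 'M[R]_n)
    (S : {set 'I_n}) i0 j0 :
  i0 \in S -> j0 \notin S ->
  (forall i j, i \in S -> j \notin S -> M i j = 0) -> decomposable_mx M.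
Proof.
move=> iS jS MS.
pose t := enum (~: S) ++ enum S.
have szt : size t = n.
  by rewrite size_cat -!cardE addnC cardsC card_ord.
have ut : uniq t.
  rewrite cat_uniq !enum_uniq andbT /=; apply/hasPn=> x.
  by rewrite !mem_enum inE negbK.
pose f (i : 'I_n) := nth i0 t i.
have finj : injective f.
  by move=> x y /eqP; rewrite nth_uniq ?szt // => /eqP /val_inj.
pose s := perm finj.
have e : (#|~: S| + #|S|)%N = n by rewrite addnC cardsC card_ord.
(* The inverse is taken so that conjugation gives the entries [M (f i) (f j)]. *)
exists (perm_mx s^-1); first exact: perm_mx_is_perm.
exists #|~: S|, #|S|, e; split.
- by apply/card_gt0P; exists j0; rewrite inE.
- by apply/card_gt0P; exists i0.
pose C := invmx (perm_mx s^-1) *m M *m perm_mx s^-1.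
have CE i j : C i j = M (f i) (f j).
  have sV : invmx (perm_mx s^-1) = perm_mx s :> 'M[R]_n.
    apply: (can_inj (mulmxK (unitmx_perm R s^-1))).
    by rewrite mulVmx ?unitmx_perm // -perm_mxM mulgV perm_mx1.
  by rewrite /C sV -row_permE -col_permE !mxE !permE.
pose D : 'M_(#|~: S| + #|S|) := castmx (esym e, esym e) C.
exists (ulsubmx D), (ursubmx D), (drsubmx D).
suff Ddl : dlsubmx D = 0 by rewrite -Ddl submxK castmxKV.
apply/matrixP=> i j; rewrite !mxE castmxE CE; apply: MS.
- rewrite /f nth_cat /= -cardE ltnNge leq_addr /= addKn -mem_enum.
  by rewrite mem_nth // -cardE.
- rewrite /f nth_cat /= -cardE ltn_ord.
  by have := mem_nth i0; rewrite -in_setC -mem_enum; apply; rewrite -cardE.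
Qed.

Lemma nonneg_mx_exp (R : realType) n (M : 'M[R]_n) k :
  nonneg_mx M -> nonneg_mx (M ^+ k).
Proof.
move=> M0; elim: k => [|k IH] i j; first by rewrite expr0 mxE ler0n.
by rewrite exprS -mulmxE mxE sumr_ge0 // => l _; rewrite mulr_ge0.
Qed.

(* The zero set of column [j] of [T] is [M]-invariant because [M T = T]; when the
   whole column vanishes, so does column [j] of [M], and the complement of [{j}]
   is used instead. *)
Lemma decomposable_of_zero_entry (R : realType) n (M T : 'M[R]_n) i j :
  nonneg_mx M -> nonneg_mx T -> M *m T = T -> (forall k l, M k l <= T k l) ->
  (1 < n)%N -> T i j = 0 -> decomposable_mx M.
Proof.
move=> M0 T0 MT leMT n1 Tij.
have [/existsP[l Tlj]|/existsPn colT] := boolP [exists l, T l j != 0].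
  apply: (@decomposable_of_invariant_set _ _ _ [set k | T k j == 0] i l).
  - by rewrite inE Tij.
  - by rewrite inE.
  - move=> k h; rewrite !inE => /eqP Tkj Thj.
    have := congr1 (fun v : 'M__ => v k j) MT; rewrite mxE Tkj => /eqP.
    rewrite psumr_eq0; last by move=> l' _; rewrite mulr_ge0.
    move=> /allP /(_ h (mem_index_enum h)) /=.
    by rewrite mulf_eq0 (negbTE Thj) orbF => /eqP.
have [i1 i1j] : exists i1, i1 != j.
  have : (0 < #|[set~ j]|)%N by rewrite cardsC1 card_ord -subn1 subn_gt0.
  by case/card_gt0P=> i1; rewrite !inE; exists i1.
apply: (@decomposable_of_invariant_set _ _ _ [set~ j] i1 j).
- by rewrite !inE.
- by rewrite !inE eqxx.
- move=> k h _; rewrite !inE negbK => /eqP ->.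
  apply/le_anti; rewrite M0 andbT (le_trans (leMT _ _)) //.
  by move: (colT k); rewrite negbK => /eqP ->.
Qed.

Lemma nonneg_potent_decomposable (R : realType) r n (M : 'M[R]_n) :
  (2 <= r)%N -> nonneg_mx M -> potent_mx r M -> (r - 1 < \rank M)%N ->
  decomposable_mx M.
Proof.
(* With [r = s.+2], the number [r - 1] of summands of [T] is [s.+1]. *)
case: r => [|[|s]] // _ M0 Mr; rewrite subn1 /= => rkM.
have n1 : (1 < n)%N.
  by apply: leq_ltn_trans (leq_trans rkM (rank_leq_row _)).
pose T := \sum_(k < s.+1) M ^+ k.+1.
have TE i j : T i j = \sum_(k < s.+1) (M ^+ k.+1) i j by rewrite summxE.
have T0 : nonneg_mx T.
  by move=> i j; rewrite TE sumr_ge0 // => k _; apply: nonneg_mx_exp.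
have MT : M *m T = T.
  (* Multiplication by [M] shifts the exponents by one, and the top power wraps around to [M] by
     potency. *)
  rewrite mulmxE /T mulr_sumr big_ord_recr big_ord_recl /= -exprS Mr addrC.
  by congr (_ + _); apply: eq_bigr => k _; rewrite -exprS.
have leMT k l : M k l <= T k l.
  rewrite TE big_ord_recl expr1 lerDl sumr_ge0 // => h _; exact: nonneg_mx_exp.
have [/existsP[i /existsP[j /eqP Tij]]|/existsPn Tn0] :=
    boolP [exists i, [exists j, T i j == 0]].
  exact: (@decomposable_of_zero_entry _ _ M T i j).
have Tpos i j : 0 < T i j.
  rewrite lt_def T0 andbT; apply: contraNN (Tn0 i) => Tij.
  by apply/existsP; exists j.
have MkT k : M ^+ k *m T = T.
  elim: k => [|k IH]; first by rewrite mulmxE expr0 mul1r.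
  by rewrite exprS -mulmxE -mulmxA IH MT.
(* Each of the [s.+1] powers in the left factor fixes [T]. *)
have TT : T *m T = T *+ s.+1.
  by rewrite {1}/T mulmx_suml (eq_bigr (fun=> T)) ?sumr_const ?card_ord.
have s0 : s.+1%:R != 0 :> R by rewrite pnatr_eq0.
pose Q := s.+1%:R^-1 *: T.
have QQ : Q *m Q = Q.
  by rewrite -scalemxAl -scalemxAr TT -scaler_nat (scalerA _ s.+1%:R) mulVf ?scale1r.
have rkQ : (\rank Q <= 1)%N.
  apply: positive_idempotent_rank QQ => i j; rewrite mxE mulr_gt0 //.
  by rewrite invr_gt0 ltr0n.
have trT : \tr T = s.+1%:R * (\rank Q)%:R.
  by rewrite -mxtrace_idempotent // mxtraceZ mulrA mulfV ?mul1r.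
pose E := M ^+ s.+1.
(* This identity makes [E] idempotent, as [E] is a positive power of [M], and bounds [\rank M] by
   [\rank E]. *)
have ME : M = E *m M by rewrite mulmxE /E -exprSr Mr.
have EE : E *m E = E.
  by rewrite {2 3}/E exprS mulmxA -ME.
(* [E] is the last summand of [T], and the others have nonnegative diagonals. *)
have trE : \tr E <= \tr T.
  apply: ler_sum => i _; rewrite TE big_ord_recr lerDr sumr_ge0 // => k _.
  exact: nonneg_mx_exp.
have rkE : (\rank M <= \rank E)%N by rewrite {1}ME mxrankM_maxl.
(* Ranks of idempotents are traces, so [trE] becomes an inequality of naturals; with [rkQ] it
   contradicts [rkM], so [T] cannot be positive. *)
have : (\rank E <= s.+1 * \rank Q)%N.
  by rewrite -(ler_nat R) natrM -trT -mxtrace_idempotent.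
move/(leq_trans rkE)/(leq_trans rkM); rewrite ltnNge; case/negP.
by rewrite -[leqRHS]muln1 leq_mul2l rkQ orbT.
Qed.

Theorem theorem5p1 (R : realType) (r : nat) (hr : (2 <= r)%N)
    (n : nat) (A : 'M[R]_n)
    (hA0 : nonneg_mx A) (hAr : potent_mx r A) (hArank : (r - 1 < \rank A)%N)
    (m : nat) (B : 'M[R]_m)
    (hB : B != 0) (hB0 : nonneg_mx B) (hBr : potent_mx r B) :
  [/\ decomposable_mx (A *t B),
      potent_mx r (A *t B) &
      (r - 1 < \rank (A *t B))%N].
Proof.
have pAB : potent_mx r (A *t B).
  by rewrite /potent_mx tensmx_exp ?hAr ?hBr // ltnW.
have rkAB := leq_trans hArank (mxrank_tensl _ _ _ _ _ A B hB).
split=> //; apply: nonneg_potent_decomposable pAB rkAB => // i j.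
by rewrite mxE mulr_ge0.
Qed.
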